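(* Let $\lambda$ be an integer partition. Then $$q^{-\alpha_{\mathrm{Quinv}}(\lambda)}\,\chi(\pi_\lambda^{\mathrm{Quinv}},q,0) = q^{-\alpha_{\mathrm{Inv}}(\lambda)}\, \chi( \pi_\lambda^{\mathrm{Inv}},q,0)$$ and $$\chi(\pi_\lambda^{\mathrm{Inv}},q,t)\big|_{t^{\# c(\pi_\lambda^{\mathrm{Inv}})}} = \chi(\pi_\lambda^{\mathrm{Quinv}},q,t)\big|_{t^{\# c(\pi_\lambda^{\mathrm{Quinv}})}}.$$
   Context: A Dyck path of semilength $n$ is a lattice path from $(0,0)$ to $(n,n)$ made of $n$ unit north steps $N$ and $n$ unit east steps $E$ staying weakly above the diagonal $x=y$; it is written as a word in $N,E$. Unit cells of the $n\times n$ grid are named by the coordinates $(i,j)$ (column $i$, row $j$) of their north-east corner, $1\le i,j\le n$. Let $h_i$ be the number of $N$ steps before the $i$-th $E$ step; the cell $(i,j)$ is below $\pi$ if $j\le h_i$ and above $\pi$ if $j>h_i$. $\mathrm{Area}(\pi)$ is the set of cells below $\pi$ and strictly above the diagonal: $\mathrm{Area}(\pi)=\{(i,j): 1\le i\le n,\ i<j\le h_i\}$. The set of corners $c(\pi)$ is the set of cells that are above $\pi$ but whose eastern neighbor $(i+1,j)$ and southern neighbor $(i,j-1)$ are both below $\pi$ (equivalently, one cell $(i,h_i+1)$ for each consecutive $EN$ in $\pi$ whose $E$ is the $i$-th $E$ step). For $w\in\mathbb{Z}_{>0}^n$ put $x_w=x_{w_1}\cdots x_{w_n}$ and $\mathrm{inv}(\pi,w)=\#\{(i,j)\in\mathrm{Area}(\pi):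 w_i>w_j\}$, and define $$\chi(\pi,q,t)=\sum_{w\in\mathbb{Z}_{>0}^n} q^{\mathrm{inv}(\pi,w)}\,t^{\#\{(i,j)\in c(\pi)\,:\,w_i\le w_j\}}\,x_w ,$$ a formal power series in $x_1,x_2,\ldots$ with coefficients in $\mathbb{Z}[q,t]$ (it is known to be a symmetric function). $F|_{t^k}$ denotes the coefficient of $t^k$ in $F$. For a partition $\lambda=(\lambda_1\ge\cdots\ge\lambda_\ell>0)$ define the Dyck paths of semilength $|\lambda|$ $$\pi_\lambda^{\mathrm{Inv}} = N^{\lambda_\ell}\cdot(EN)^{\lambda_\ell} N^{\lambda_{\ell-1}-\lambda_{\ell}}\cdot(EN)^{\lambda_{\ell-1}} N^{\lambda_{\ell-2}-\lambda_{\ell-1}} \cdots (EN)^{\lambda_2} N^{\lambda_1-\lambda_2} \cdot E^{\lambda_1},$$ $$\pi_\lambda^{\mathrm{Quinv}} = N^{\lambda_\ell}\cdot N^{\lambda_{\ell-1}-\lambda_{\ell}}(EN)^{\lambda_\ell} \cdot N^{\lambda_{\ell-2}-\lambda_{\ell-1}}(EN)^{\lambda_{\ell-1}} \cdots N^{\lambda_1-\lambda_2}(EN)^{\lambda_2} \cdot E^{\lambda_1}.$$ Let $\lambda'$ be the conjugate partition. For a box $u$ of $\lambda$ in row $i$ and column $j$ ($1\le j\le\lambda_i$), $\mathrm{arm}(u)=\lambda_i-j$, $\mathrm{leg}(u)=\lambda'_j-i$, $\mathrm{coleg}(u)=i-1$. Set $$\alpha_{\mathrm{Inv}}(\lambda)=\sum_{u\in\lambda,\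 \mathrm{coleg}(u)\ne0}\mathrm{arm}(u),\qquad \alpha_{\mathrm{Quinv}}(\lambda)=\sum_{u\in\lambda,\ \mathrm{leg}(u)\ne0}\mathrm{arm}(u).$$ *)

(* Defs.v *)
From HB Require Import structures.
From mathcomp Require Import all_boot all_order all_algebra.
From mathcomp Require Import fraction finmap.
From mathcomp Require Import monalg.
From mathcomp Require Import zify.

Set Implicit Arguments.
Unset Strict Implicit.
Unset Printing Implicit Defensive.

Import GRing.Theory.

Local Open Scope nat_scope.

Inductive step := North | East.

Definition eq_step (x y : step) : bool :=
  match x, y with North, North | East, East => true | _, _ => false end.
Lemma eq_stepP : Equality.axiom eq_step.
Proof. by do 2!case; constructor. Qed.
HB.instance Definition _ := hasDecEq.Build step eq_stepP.

(* Staying weakly above x = y means that no prefix has more E's than N's. *)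
Definition is_dyck (n : nat) (s : seq step) : bool :=
  [&& count_mem North s == n, count_mem East s == n &
      all (fun k => count_mem East (take k s) <= count_mem North (take k s))
          (iota 0 (size s).+1)].

Record dyck (n : nat) := Dyck {
  dyck_word :> seq step;
  dyck_wordP : is_dyck n dyck_word
}.

(* The list of the numbers of N steps preceding each E step, given that a
   number a of N steps has already been seen. *)
Fixpoint east_heights (a : nat) (s : seq step) : seq nat :=
  match s with
  | [::] => [::]
  | North :: s' => east_heights a.+1 s'
  | East :: s' => a :: east_heights a s'
  end.

(* Columns, rows and letters are numbered from 0: the pair (i, j) stands for
   the cell whose north-east corner is (i + 1, j + 1), so that "j <= h_i" in
   coordinates starting from 1 reads j < height pi i here.  Out of the grid
   (n <= i) the height is 0. *)
Definition height n (pi : dyck n) (i : nat) : nat :=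
  nth 0 (east_heights 0 pi) i.

Definition below n (pi : dyck n) (i j : nat) : bool := j < height pi i.

Definition Area n (pi : dyck n) : {set 'I_n * 'I_n} :=
  [set c : 'I_n * 'I_n | (c.1 < c.2) && below pi c.1 c.2].

(* A cell of the bottom row is never a corner: for c.2 = 0 the predecessor is
   0 again and the first and third conditions are contradictory. *)
Definition corners n (pi : dyck n) : {set 'I_n * 'I_n} :=
  [set c : 'I_n * 'I_n |
    [&& ~~ below pi c.1 c.2, below pi c.1.+1 c.2 & below pi c.1 c.2.-1]].

Definition posnat := {k : nat | 0 < k}.

Definition inv n (pi : dyck n) (w : n.-tuple posnat) : nat :=
  #|[set c in Area pi | val (tnth w c.1) > val (tnth w c.2)]|.

Definition corner_stat n (pi : dyck n) (w : n.-tuple posnat) : nat :=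
  #|[set c in corners pi | val (tnth w c.1) <= val (tnth w c.2)]|.

(* {cmonom posnat} is the type of monomials in x_1, x_2, ... *)
Definition xmon n (w : n.-tuple posnat) : {cmonom posnat} :=
  \big[mmul/mone]_(i < n) ucm (tnth w i).

(* A formal power series in x_1, x_2, ... is its family of coefficients. *)
Definition fps (R : Type) := {cmonom posnat} -> R.

(* The coefficient ring Z[q,t] is Z[q][t]. *)
Definition qvar : {poly {poly int}} := ('X%:P)%R.
Definition tvar : {poly {poly int}} := 'X%R.

(* The coefficient of m collects the words w with x_w = m. Their letters lie in
   the support of m (lemma xmon_support), so the words over that finite alphabet
   are the only ones to be considered. *)
Definition chi n (pi : dyck n) : fps {poly {poly int}} := fun m =>
  (\sum_(w : n.-tuple (finsupp m) | xmon (map_tuple val w) == m)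
     qvar ^+ inv pi (map_tuple val w) *
     tvar ^+ corner_stat pi (map_tuple val w))%R.

Lemma xmon_support n (w : n.-tuple posnat) (i : 'I_n) :
  tnth w i \in finsupp (xmon w).
Proof.
by rewrite /xmon (bigD1 i) //= mdomD in_fsetU mdomU in_fset1 eqxx.
Qed.

Definition t_eq0 (F : fps {poly {poly int}}) : fps {poly int} :=
  fun m => (F m).[0]%R.

Definition t_coef (k : nat) (F : fps {poly {poly int}}) : fps {poly int} :=
  fun m => ((F m)`_k)%R.

(* q^{-a} F, computed over the field of fractions of Z[q], which contains the
   Laurent polynomials in q. *)
Definition qshift (a : nat) (F : fps {poly int}) : fps {fraction {poly int}} :=
  fun m => ((tofrac 'X) ^- a * tofrac (F m))%R.

Definition is_intpart (lam : seq nat) : bool :=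
  sorted geq lam && (0 \notin lam).

Record intpart := IntPart {
  parts :> seq nat;
  partsP : is_intpart parts
}.

(* lambda_i, numbered from 1; it is 0 for i > l, and part lam 0 is a dummy
   value, which only occurs below for the empty partition, where it is 0. *)
Definition part (lam : seq nat) (i : nat) : nat := nth 0 lam i.-1.

Definition conj_part (lam : seq nat) (j : nat) : nat :=
  count (fun a => j <= a) lam.

(* For the box in row i and column j, both numbered from 1; on boxes of the
   diagram the natural-number subtractions are exact. *)
Definition arm (lam : seq nat) (i j : nat) : nat := part lam i - j.
Definition leg (lam : seq nat) (i j : nat) : nat := conj_part lam j - i.
Definition coleg (i j : nat) : nat := i - 1.

Definition alpha_Inv (lam : seq nat) : nat :=
  \sum_(1 <= i < (size lam).+1) \sum_(1 <= j < (part lam i).+1 | coleg i j != 0)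
     arm lam i j.

Definition alpha_Quinv (lam : seq nat) : nat :=
  \sum_(1 <= i < (size lam).+1) \sum_(1 <= j < (part lam i).+1 | leg lam i j != 0)
     arm lam i j.

Definition Ns (k : nat) : seq step := nseq k North.
Definition Es (k : nat) : seq step := nseq k East.
Definition ENs (k : nat) : seq step := flatten (nseq k [:: East; North]).

(* N^{lambda_l} seg(l) seg(l-1) ... seg(2) E^{lambda_1} *)
Definition path_word (lam : seq nat) (seg : nat -> seq step) : seq step :=
  Ns (part lam (size lam)) ++
  flatten [seq seg k | k <- rev (iota 2 (size lam).-1)] ++
  Es (part lam 1).

Definition pi_Inv_word (lam : seq nat) : seq step :=
  path_word lam (fun k => ENs (part lam k) ++ Ns (part lam k.-1 - part lam k)).

Definition pi_Quinv_word (lam : seq nat) : seq step :=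
  path_word lam (fun k => Ns (part lam k.-1 - part lam k) ++ ENs (part lam k)).

Fixpoint stays_above (a : nat) (s : seq step) : bool :=
  match s with
  | [::] => true
  | North :: s' => stays_above a.+1 s'
  | East :: s' => (0 < a) && stays_above a.-1 s'
  end.

Lemma stays_aboveP a s k : stays_above a s ->
  count_mem East (take k s) <= a + count_mem North (take k s).
Proof.
elim: s a k => [|x s IHs] a [|k] //=; case: x => /=.
  by move=> /(IHs _ k) /=; lia.
by case/andP=> a0 /(IHs _ k) /=; lia.
Qed.

Lemma stays_above_Ns a k s : stays_above a (Ns k ++ s) = stays_above (a + k) s.
Proof. by elim: k a => [|k IHk] a /=; rewrite ?addn0 // IHk addSnnS. Qed.

Lemma stays_above_ENs a k s :
  0 < a -> stays_above a (ENs k ++ s) = stays_above a s.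
Proof.
by move=> a0; elim: k => [|k IHk] //=; rewrite a0 /= prednK.
Qed.

Lemma stays_above_Es a : stays_above a (Es a).
Proof. by elim: a. Qed.

Lemma count_ENs x k : count_mem x (ENs k) = k.
Proof. by elim: k => [|k IHk] //=; rewrite IHk; case: x {IHk}. Qed.

Lemma path_word_dyck (lam : intpart) (seg : nat -> seq step) :
    (forall k s, 1 < k <= size lam ->
       stays_above (part lam k) (seg k ++ s) = stays_above (part lam k.-1) s) ->
    (forall k, 1 < k <= size lam ->
       count_mem North (seg k) = part lam k.-1 /\
       count_mem East (seg k) = part lam k) ->
  is_dyck (sumn lam) (path_word lam seg).
Proof.
move=> segP segC; rewrite /path_word.
pose T k := flatten [seq seg j | j <- rev (iota 2 k.-1)] ++ Es (part lam 1).
pose S k := sumn (take k lam).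
have TS k : T k.+2 = seg k.+2 ++ T k.+1.
  by rewrite /T -[k.+2.-1]addn1 iotaD rev_cat /= catA.
have SS k : k < size lam -> S k.+1 = S k + part lam k.+1.
  by move=> kl; rewrite /S (take_nth 0) // sumn_rcons.
have main k : k < size lam -> [/\ stays_above (part lam k.+1) (T k.+1),
    count_mem North (T k.+1) + part lam k.+1 = S k.+1 &
    count_mem East (T k.+1) = S k.+1].
  elim: k => [|k IHk] kl.
    rewrite SS // /S take0 /= /T /= stays_above_Es.
    by rewrite !count_nseq /= mul0n mul1n.
  have [IH1 IH2 IH3] := IHk (ltnW kl).
  have [sN sE] := segC k.+2 kl.
  rewrite TS segP // ![count_mem _ (seg _ ++ _)]count_cat sN sE (SS k.+1) //.
  rewrite -[k.+2.-1]/k.+1; split=> //.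
    by rewrite -IH2 [part _ _ + _]addnC.
  by rewrite IH3 addnC.
have dyckP n s : stays_above 0 s -> count_mem North s = n ->
    count_mem East s = n -> is_dyck n s.
  move=> s0 sN sE; rewrite /is_dyck sN sE !eqxx.
  by apply/and3P; split=> //; apply/allP=> k _; apply: (@stays_aboveP 0).
case: (posnP (size lam)) => [/size0nil ->|l0].
  by [].
have [] := main (size lam).-1 _; first by rewrite prednK.
rewrite prednK // /S take_size => m1 m2 m3.
apply: dyckP; first by rewrite stays_above_Ns.
  by rewrite count_cat -/(T (size lam)) -m2 count_nseq /= mul1n addnC.
by rewrite count_cat -/(T (size lam)) -m3 count_nseq.
Qed.

Lemma part_gt0 (lam : intpart) k : 0 < k <= size lam -> 0 < part lam k.
Proof.
case: lam => lam /= /andP[_ lam0]; case: k => //= k kl.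
by rewrite lt0n; apply: contraNneq lam0 => <-; apply: mem_nth.
Qed.

Lemma part_le (lam : intpart) k : 1 < k <= size lam ->
  part lam k <= part lam k.-1.
Proof.
case: lam => lam /= /andP[lamS _]; case: k => [|[|k]] //= kl.
by apply: (sortedP 0 lamS).
Qed.

Lemma pi_Inv_dyck (lam : intpart) : is_dyck (sumn lam) (pi_Inv_word lam).
Proof.
apply: path_word_dyck => k => [s|] kl; have kle := part_le kl.
  have k0 : 0 < part lam k by apply: part_gt0; lia.
  by rewrite -catA stays_above_ENs // stays_above_Ns subnKC.
by rewrite !count_cat !count_ENs !count_nseq /=; split; lia.
Qed.

Lemma pi_Quinv_dyck (lam : intpart) : is_dyck (sumn lam) (pi_Quinv_word lam).
Proof.
apply: path_word_dyck => k => [s|] kl; have kle := part_le kl.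
  have k0 : 0 < part lam k.-1 by apply: part_gt0; lia.
  by rewrite -catA stays_above_Ns subnKC // stays_above_ENs.
by rewrite !count_cat !count_ENs !count_nseq /=; split; lia.
Qed.

Definition pi_Inv (lam : intpart) : dyck (sumn lam) := Dyck (pi_Inv_dyck lam).
Definition pi_Quinv (lam : intpart) : dyck (sumn lam) :=
  Dyck (pi_Quinv_dyck lam).

(* Main.v *)
From mathcomp Require Import all_boot all_order all_algebra.
From mathcomp Require Import fraction finmap monalg zify.
Require Import Defs.

(** Read a word along the path as a filling of a diagram with lam_r cells in
    the row r, from the top row down and from left to right.  For both paths a
    corner is then a pair of vertically adjacent cells, and the area consists of
    the pairs of cells in one row and of the pairs formed by a cell and a cell
    of the next lower row strictly to its left.  For the Inv path the rows are
    aligned to the left, so the column heights are the conjugate partition in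
    decreasing order; for the Quinv path they are aligned to the right and the
    heights are increasing ([chi_Inv], [chi_Quinv]).  The coefficient of t^0
    keeps the fillings whose columns increase strictly upwards, the top
    coefficient those whose columns decrease weakly.  It remains to see how the
    generating function of these fillings depends on the order of the columns.

    Inversions are counted between pairs of columns, and the interaction of a
    column with the others is a sum over its rows.  So two adjacent columns may
    be modified freely as long as each row keeps its two entries.  If their
    heights differ, exchange their tails above the highest row where both
    columns stay monotone, and the columns entirely if there is no such row
    ([swapcol]).  This involution exchanges the two heights.  Above the row of
    the exchange, monotonicity leaves a single way to match the consecutive
    rows, and it follows that the number of inversions increases by exactly 1 in
    the strict case, and does not change in the weak case, when the taller
    column goes to the right ([exch_colinv], [swapcol_colinv]).

    Reversing the order of the columns by such steps multiplies the generating
    function by q to the number of pairs of columns of distinct heights in the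
    strict case, and by 1 in the weak case ([shapesum_rev]).  That number of
    pairs is the difference of the two exponents alpha ([alpha_descents]). *)

Set Implicit Arguments.
Unset Strict Implicit.
Unset Printing Implicit Defensive.

Import GRing.Theory.

Local Open Scope nat_scope.

(** * Exchanging the tails of two columns *)

(** The relation that an entry l must have to the entry u just above it: for
    s = true no corner counts in the exponent of t (the coefficient of t^0),
    for s = false every corner does (the top coefficient). *)
Definition climbs (s : bool) (l u : posnat) : bool :=
  if s then val l < val u else val u <= val l.

Definition exceeded (x : posnat) (d : seq posnat) : bool :=
  if d is y :: _ then val x < val y else false.

(** A column lists its entries from the bottom row up; c stands somewhere to the
    left of d.  An entry of c attacks the entry of d in its own row, and an
    entry of d attacks the entry of c one row lower; these are the only
    attacks between the two columns. *)
Fixpoint colinv (c d : seq posnat) : nat :=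
  match c, d with
  | x :: c', y :: d' => (val y < val x) + exceeded x d' + colinv c' d'
  | _, _ => 0
  end.

Definition supports (s : bool) (x : posnat) (d : seq posnat) : bool :=
  if d is y :: _ then climbs s x y else true.

(** The tails c and d stand on x and y.  They are exchanged above the highest
    row where both columns stay monotone after the exchange; None means that
    there is no such row.  Choosing the highest row makes the exchange an
    involution and forces every row above it into the rigid situation
    analysed in [exch_colinv]. *)
Fixpoint exch (s : bool) (x y : posnat) (c d : seq posnat) :
    option (seq posnat * seq posnat) :=
  let here := if supports s x d && supports s y c then Some (d, c) else None in
  match c, d with
  | x' :: c', y' :: d' =>
      if exch s x' y' c' d' is Some p then Some (x' :: p.1, y' :: p.2)
      else here
  | _, _ => here
  end.

(** When the tails cannot be exchanged above any row, the columns are exchanged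
    entirely. *)
Definition swapcol (s : bool) (L R : seq posnat) : seq posnat * seq posnat :=
  match L, R with
  | x :: c, y :: d =>
      if exch s x y c d is Some p then (x :: p.1, y :: p.2) else (R, L)
  | _, _ => (R, L)
  end.

Lemma colinv_nil c : colinv c [::] = 0. Proof. by case: c. Qed.

Lemma exchC s x y c d :
  exch s y x d c = omap (fun p => (p.2, p.1)) (exch s x y c d).
Proof.
elim: c d x y => [|x' c IHc] [|y' d] x y //=; rewrite ?andbT; try by case: ifP.
by rewrite IHc; case: exch => //=; rewrite andbC; case: ifP.
Qed.

(** The only consequence of the definition that matters for the rest of the
    filling: two tails starting in the same row change places, so that every
    row keeps its set of entries. *)
Lemma exch_split s x y c d p : exch s x y c d = Some p ->
  exists c1 c2 d1 d2, [/\ c = c1 ++ c2, d = d1 ++ d2, size c1 = size d1 &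
                         p = (c1 ++ d2, d1 ++ c2)].
Proof.
elim: c d x y p => [|x' c IHc] [|y' d] x y p /=.
- by case=> <-; exists [::], [::], [::], [::].
- by case: ifP => // _ [<-]; exists [::], [::], [::], (y' :: d).
- by case: ifP => // _ [<-]; exists [::], (x' :: c), [::], [::].
case E: exch => [q|].
  have [c1 [c2 [d1 [d2 [-> -> sz ->]]]]] := IHc _ _ _ _ E.
  by case=> <-; exists (x' :: c1), c2, (y' :: d1), d2; rewrite /= sz.
by case: ifP => // _ [<-]; exists [::], (x' :: c), [::], (y' :: d).
Qed.

Lemma swapcol_split s L R :
  exists c1 c2 d1 d2, [/\ L = c1 ++ c2, R = d1 ++ d2, size c1 = size d1 &
                         swapcol s L R = (c1 ++ d2, d1 ++ c2)].
Proof.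
case: L R => [|x c] [|y d] /=.
- by exists [::], [::], [::], [::].
- by exists [::], [::], [::], (y :: d).
- by exists [::], (x :: c), [::], [::].
case E: exch => [q|]; last by exists [::], (x :: c), [::], (y :: d).
have [c1 [c2 [d1 [d2 [-> -> sz ->]]]]] := exch_split E.
by exists (x :: c1), c2, (y :: d1), d2; rewrite /= sz.
Qed.

Lemma path_supports s x c :
  path (climbs s) x c = supports s x c && sorted (climbs s) c.
Proof. by case: c. Qed.

Lemma exch_path s x y c d p : exch s x y c d = Some p ->
    path (climbs s) x c -> path (climbs s) y d ->
  path (climbs s) x p.1 && path (climbs s) y p.2.
Proof.
have here c' d' x' y' : supports s x' d' && supports s y' c' ->
    path (climbs s) x' c' -> path (climbs s) y' d' ->
    path (climbs s) x' d' && path (climbs s) y' c'.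
  by rewrite !path_supports => /andP[-> ->] /andP[_ ->] /andP[_ ->].
elim: c d x y p => [|x' c IHc] [|y' d] x y p.
- by case=> <-.
- by rewrite /exch; case: ifP => // h [<-]; apply: here.
- by rewrite /exch; case: ifP => // h [<-]; apply: here.
rewrite [exch _ _ _ _ _]/=; case E: exch => [q|].
  by case=> <- /= /andP[-> xc] /andP[-> yd] /=; apply: IHc E xc yd.
by case: ifP => // h [<-]; apply: here.
Qed.

Lemma swapcol_sorted s L R :
    sorted (climbs s) L -> sorted (climbs s) R ->
  sorted (climbs s) (swapcol s L R).1 && sorted (climbs s) (swapcol s L R).2.
Proof.
case: L R => [|x c] [|y d] //= xc yd; try by rewrite ?xc ?yd.
case E: exch => [q|] /=; first exact: exch_path E xc yd.
by rewrite xc yd.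
Qed.

(** Exchanging the tails back above the same row is possible because the
    original columns were monotone there; no higher row becomes available,
    since above the exchange the two columns are the old ones with their names
    swapped ([exchC]). *)
Lemma exchK s x y c d p : exch s x y c d = Some p ->
    path (climbs s) x c -> path (climbs s) y d ->
  exch s x y p.1 p.2 = Some (c, d).
Proof.
elim: c d x y p => [|x' c IHc] [|y' d] x y p /=.
- by case=> <-.
- by case: ifP => // h [<-] _ /andP[h' _] /=; rewrite h'.
- by case: ifP => // h [<-] /andP[h' _] _ /=; rewrite h'.
case E: exch => [q|].
  by case=> <- /andP[_ xc] /andP[_ yd] /=; rewrite (IHc _ _ _ _ E).
case: ifP => // h [<-] /andP[hx _] /andP[hy _] /=.
by rewrite exchC E /= hx hy.
Qed.

Lemma swapcolK s L R : sorted (climbs s) L -> sorted (climbs s) R ->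
  swapcol s (swapcol s L R).1 (swapcol s L R).2 = (L, R).
Proof.
case: L R => [|x c] [|y d] //= xc yd.
case E: exch => [q|] /=; first by rewrite (exchK E).
by rewrite exchC E.
Qed.

(** The heart of the proof.  Let d be shorter than c.  At the row of the
    exchange, an attack from the right column down to x is always an inversion
    if s = true and never one if s = false.  Where no exchange is possible, the
    inversion inside a row and the one between the right entry of the next row
    and the left entry of this row add up to a number that does not depend on
    which column is on the left.  At the top of the shorter column there is
    one more attack when the taller column is on the right; together with the
    inversion inside that row it yields the extra term s. *)
Lemma exch_colinv s x y c d : size d < size c ->
    path (climbs s) x c -> path (climbs s) y d ->
  colinv (x :: c) (y :: d) + s =
    if exch s x y c d is Some p then colinv (x :: p.1) (y :: p.2)
    else colinv (y :: d) (x :: c).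
Proof.
elim: c d x y => [|x' c IHc] [|y' d] x y //.
  move=> {IHc} _ /=; rewrite /climbs.
  by case: s => /= /andP[xx' _] _; case: ifP => /= h; rewrite ?colinv_nil; lia.
move=> dc /= /andP[xx' xc] /andP[yy' yd].
have {IHc} := IHc d x' y' dc xc yd.
(* If the tails are exchanged further up, the entries of this
   row and of the next one stay. *)
case: exch => [p|] /=; first by lia.
move: xx' yy' xc yd; rewrite /climbs.
by case: s => /= xx' yy' _ _ h; case: ifP => /= h'; lia.
Qed.

Lemma swapcol_colinv s L R : size R < size L -> 0 < size R ->
    sorted (climbs s) L -> sorted (climbs s) R ->
  colinv (swapcol s L R).1 (swapcol s L R).2 = colinv L R + s.
Proof.
case: L R => [|x c] [|y d] // dc _ xc yd; rewrite exch_colinv //= /swapcol.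
by case: exch.
Qed.

(** The inversions between e and a column form a sum over the rows of that
    column, so two columns on the same side of e may exchange tails. *)
Lemma colinv_exchange_l e c1 c2 d1 d2 : size c1 = size d1 ->
  colinv e (c1 ++ d2) + colinv e (d1 ++ c2) =
  colinv e (c1 ++ c2) + colinv e (d1 ++ d2).
Proof.
elim: e c1 d1 => [|z e IHe] [|x c1] [|y d1] //=; first by rewrite addnC.
case=> sz; have := IHe _ _ sz.
case: c1 d1 sz => [|? ?] [|? ?] //=; lia.
Qed.

Lemma colinv_exchange_r e c1 c2 d1 d2 : size c1 = size d1 ->
  colinv (c1 ++ d2) e + colinv (d1 ++ c2) e =
  colinv (c1 ++ c2) e + colinv (d1 ++ d2) e.
Proof.
elim: e c1 d1 => [|z e IHe] [|x c1] [|y d1] //=; rewrite ?colinv_nil //.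
  by rewrite addnC.
by case=> sz; have := IHe _ _ sz; lia.
Qed.

(** * Fillings of a given shape *)

Lemma big_seq_bij (V : nmodType) (I J : eqType) (r : seq I) (r' : seq J)
    (P : pred I) (P' : pred J) (F : I -> V) (F' : J -> V) (f : I -> J) :
    uniq r -> uniq r' ->
    (forall x, x \in r -> P x -> [/\ f x \in r', P' (f x) & F' (f x) = F x]) ->
    {in [pred x in r | P x] &, injective f} ->
    (forall y, y \in r' -> P' y -> exists x, [/\ x \in r, P x & f x = y]) ->
  (\sum_(x <- r | P x) F x = \sum_(y <- r' | P' y) F' y)%R.
Proof.
move=> Ur Ur' fP f_inj f_surj; rewrite -big_filter -[RHS]big_filter.
have fE : perm_eq (map f (filter P r)) (filter P' r').
  apply: uniq_perm; first 1 last.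
  - by rewrite filter_uniq.
  - move=> y; apply/mapP/idP => [[x] | ].
      by rewrite !mem_filter => /andP[Px rx] ->; have [-> ->] := fP x rx Px.
    rewrite mem_filter => /andP[Py ry]; have [x [rx Px fx]] := f_surj y ry Py.
    by exists x; rewrite ?mem_filter ?Px.
  rewrite map_inj_in_uniq ?filter_uniq // => x y; rewrite !mem_filter.
  by move=> xr yr; apply: f_inj; rewrite inE andbC.
rewrite -(perm_big _ fE) big_map /=; apply: eq_big_seq => x.
by rewrite mem_filter => /andP[Px rx]; have [_ _ ->] := fP x rx Px.
Qed.

Definition words (D : {fset posnat}) (n : nat) : seq (seq posnat) :=
  [seq map val (tval w) | w <- enum {: n.-tuple D}].

Definition fillings (D : {fset posnat}) (al : seq nat) :=
  [seq reshape al s | s <- words D (sumn al)].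

Lemma words_uniq D n : uniq (words D n).
Proof.
rewrite map_inj_uniq ?enum_uniq // => u w /(inj_map val_inj) e.
exact: val_inj.
Qed.

Lemma mem_words D n s : (s \in words D n) = (size s == n) && all (mem D) s.
Proof.
apply/mapP/andP => [[w _ ->]|[/eqP <- sD]].
  rewrite size_map size_tuple; split=> //.
  by apply/allP=> x /mapP[y _ ->]; exact: valP.
have e : map val (pmap (insub : posnat -> option D) s) = s.
  rewrite (pmap_filter (@insubK _ _ _)); apply/all_filterP.
  by apply: sub_all sD => x xD; rewrite isSome_insub.
have sz : size (pmap (insub : posnat -> option D) s) == size s.
  by rewrite -[in X in _ == X]e size_map.
by exists (Tuple sz); rewrite ?mem_enum.
Qed.

(** The word of a filling is the concatenation of its columns, from which the
    shape recovers the filling. *)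
Lemma fillings_uniq D al : uniq (fillings D al).
Proof.
rewrite map_inj_in_uniq ?words_uniq // => u w.
rewrite !mem_words => /andP[/eqP su _] /andP[/eqP sw _] /(congr1 flatten).
by rewrite !reshapeKr ?su ?sw.
Qed.

Lemma mem_fillings D al T :
  (T \in fillings D al) = (shape T == al) && all (mem D) (flatten T).
Proof.
apply/mapP/andP => [[s] | [/eqP <- TD]].
  rewrite mem_words => /andP[/eqP sz sD] ->.
  by rewrite reshapeKr ?sz // reshapeKl ?sz // eqxx.
by exists (flatten T); rewrite ?flattenK // mem_words size_flatten eqxx.
Qed.

Fixpoint fillinv (T : seq (seq posnat)) : nat :=
  if T is c :: T' then \sum_(d <- T') colinv c d + fillinv T' else 0.

Definition content (s : seq posnat) : {cmonom posnat} :=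
  \big[mmul/mone]_(x <- s) ucm x.

(** The coefficient of the monomial m in the q-generating function of the
    monotone fillings of the shape with column heights al (any composition). *)
Definition shapesum (s : bool) (m : {cmonom posnat}) (al : seq nat) :
    {poly int} :=
  (\sum_(T <- fillings (finsupp m) al |
      all (sorted (climbs s)) T && (content (flatten T) == m))
     'X^(fillinv T))%R.

Lemma content_perm s1 s2 : perm_eq s1 s2 -> content s1 = content s2.
Proof. exact: perm_big. Qed.

Lemma fillinv_cat P Q :
  fillinv (P ++ Q) =
  fillinv P + fillinv Q + \sum_(c <- P) \sum_(d <- Q) colinv c d.
Proof.
elim: P => [|c P IHP] /=; first by rewrite big_nil addn0.
by rewrite IHP big_cat big_cons /=; lia.
Qed.

Definition swapcols_at (s : bool) (k : nat) (T : seq (seq posnat)) :=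
  take k T ++
  (if drop k T is L :: R :: Q then
     (swapcol s L R).1 :: (swapcol s L R).2 :: Q
   else [::]).

Lemma swapcols_at_cat s P L R Q :
  swapcols_at s (size P) (P ++ L :: R :: Q) =
  P ++ (swapcol s L R).1 :: (swapcol s L R).2 :: Q.
Proof. by rewrite /swapcols_at take_size_cat // drop_size_cat. Qed.

Lemma swapcol_perm s L R :
  perm_eq ((swapcol s L R).1 ++ (swapcol s L R).2) (L ++ R).
Proof.
have [c1 [c2 [d1 [d2 [-> -> _ ->]]]]] := swapcol_split s L R.
by apply/permP=> a; rewrite /= !count_cat; lia.
Qed.

Lemma swapcol_size s L R :
  size (swapcol s L R).1 = size R /\ size (swapcol s L R).2 = size L.
Proof.
have [c1 [c2 [d1 [d2 [-> -> sz ->]]]]] := swapcol_split s L R.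
by rewrite /= !size_cat sz.
Qed.

Lemma shape_pair P0 a b q (T : seq (seq posnat)) :
    shape T = P0 ++ a :: b :: q ->
  exists P L R Q, [/\ T = P ++ L :: R :: Q, size P = size P0,
     size L = a & size R = b].
Proof.
move=> sT; have := congr1 (take (size P0)) sT.
have := congr1 (drop (size P0)) sT.
rewrite take_size_cat // drop_size_cat // /shape -map_drop -map_take.
case e : (drop _ T) => [|L [|R Q]] //= [La Rb _] tP.
exists (take (size P0) T), L, R, Q; split=> //.
- by rewrite -e cat_take_drop.
- by rewrite -[in RHS]tP size_map.
Qed.

Lemma fillinv_swapcols_at s P L R Q : size R < size L -> 0 < size R ->
    sorted (climbs s) L -> sorted (climbs s) R ->
  fillinv (swapcols_at s (size P) (P ++ L :: R :: Q)) =
  fillinv (P ++ L :: R :: Q) + s.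
Proof.
move=> ba b0 Ls Rs; rewrite swapcols_at_cat !fillinv_cat /= !big_cons.
rewrite swapcol_colinv //.
have [c1 [c2 [d1 [d2 [-> -> sz ->]]]]] := swapcol_split s L R.
have -> : \sum_(c <- P) \sum_(d <- [:: c1 ++ d2, d1 ++ c2 & Q]) colinv c d =
    \sum_(c <- P) \sum_(d <- [:: c1 ++ c2, d1 ++ d2 & Q]) colinv c d.
  apply: eq_bigr => c _; rewrite !big_cons.
  by have := colinv_exchange_l c c2 d2 sz; lia.
have : \sum_(e <- Q) (colinv (c1 ++ d2) e + colinv (d1 ++ c2) e) =
    \sum_(e <- Q) (colinv (c1 ++ c2) e + colinv (d1 ++ d2) e).
  by apply: eq_bigr => e _; rewrite colinv_exchange_r.
by rewrite !big_split /=; lia.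
Qed.

Lemma swapcols_at_filling s D p a b q T :
    T \in fillings D (p ++ a :: b :: q) -> all (sorted (climbs s)) T ->
  [/\ swapcols_at s (size p) T \in fillings D (p ++ b :: a :: q),
      all (sorted (climbs s)) (swapcols_at s (size p) T),
      content (flatten (swapcols_at s (size p) T)) = content (flatten T) &
      swapcols_at s (size p) (swapcols_at s (size p) T) = T].
Proof.
rewrite !mem_fillings => /andP[/eqP sT TD].
have [P [L [R [Q [eT eP La Rb]]]]] := shape_pair sT.
move: sT TD; rewrite eT -eP swapcols_at_cat all_cat /=.
move=> sT TD /and4P[sP sL sR sQ].
have [s1 s2] := swapcol_size s L R.
have e : perm_eq (flatten (P ++ (swapcol s L R).1 :: (swapcol s L R).2 :: Q))
    (flatten (P ++ L :: R :: Q)).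
  rewrite !flatten_cat perm_cat2l /= !catA perm_cat2r; exact: swapcol_perm.
split.
- rewrite (perm_all _ e) TD andbT /shape map_cat /= s1 s2.
  move: sT; rewrite /shape map_cat /= La Rb => /eqP.
  rewrite !eqseq_cat ?size_map ?eP // => /andP[/eqP-> /eqP[->]].
  by rewrite !eqxx.
- by rewrite all_cat /= sP sQ andbT; have /andP[-> ->] := swapcol_sorted sL sR.
- exact: content_perm.
- by rewrite swapcols_at_cat swapcolK.
Qed.

(** * Sorting the columns *)

(** Moving the taller of two adjacent columns to the right gains one inversion
    in the strict case and none in the weak case, by the involution [swapcol]. *)
Lemma shapesum_swap s m p a b q : b < a -> 0 < b ->
  (shapesum s m (p ++ b :: a :: q) = shapesum s m (p ++ a :: b :: q) * 'X^s)%R.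
Proof.
move=> ba b0; rewrite /shapesum big_distrl /=; apply/esym.
apply: (@big_seq_bij _ _ _ _ _ _ _ _ _ (swapcols_at s (size p)));
  rewrite ?fillings_uniq //.
- move=> T TF /andP[Ts /eqP Tm].
  have [-> -> -> _] := swapcols_at_filling TF Ts; rewrite Tm eqxx; split=> //.
  rewrite -exprD; congr ('X^_)%R.
  move: TF; rewrite mem_fillings => /andP[/eqP sT _].
  have [P [L [R [Q [eT <- La Rb]]]]] := shape_pair sT.
  move: Ts; rewrite eT all_cat /= => /and4P[_ sL sR _].
  by rewrite fillinv_swapcols_at ?La ?Rb.
- move=> T U /andP[TF /andP[Ts _]] /andP[UF /andP[Us _]] e.
  have [_ _ _ <-] := swapcols_at_filling TF Ts.
  by have [_ _ _ <-] := swapcols_at_filling UF Us; rewrite e.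
move=> T TF /andP[Ts /eqP Tm]; have [F S C K] := swapcols_at_filling TF Ts.
by exists (swapcols_at s (size p) T); rewrite F S C Tm eqxx K.
Qed.

Lemma geq_trans : transitive geq.
Proof. by move=> y x z yx zy; exact: leq_trans zy yx. Qed.

(** On a weakly decreasing sequence this counts the pairs of distinct
    entries. *)
Fixpoint descending_pairs (al : seq nat) : nat :=
  if al is a :: al' then
    count (fun b : nat => b < a) al' + descending_pairs al'
  else 0.

(** A column that is at least as tall as the columns to its right moves past
    them, gaining a factor q^s for each one of a smaller height.  Two columns of
    the same height need not be moved, since only the shape counts. *)
Lemma shapesum_push s m p a al q : all (fun b : nat => 0 < b <= a) al ->
  (shapesum s m (p ++ al ++ a :: q) =
   shapesum s m (p ++ a :: al ++ q) * 'X^(s * count (fun b => b < a)%N al))%R.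
Proof.
elim: al p => [|b al IHal] p /=; first by rewrite muln0 expr0 mulr1.
case/andP=> /andP[b0 ba] h.
rewrite -cat_rcons IHal // cat_rcons.
move: ba; rewrite leq_eqVlt => /orP[/eqP->|ba]; first by rewrite ltnn.
by rewrite shapesum_swap // ba mulnDr muln1 exprD mulrA.
Qed.

Lemma shapesum_rev s m p al q : sorted geq al -> 0 \notin al ->
  (shapesum s m (p ++ rev al ++ q) =
   shapesum s m (p ++ al ++ q) * 'X^(s * descending_pairs al))%R.
Proof.
elim: al p q => [|a al IHal] p q; first by rewrite /= muln0 expr0 mulr1.
rewrite inE negb_or => /= sa /andP[a0 al0].
rewrite rev_cons cat_rcons IHal ?(path_sorted sa) //.
rewrite shapesum_push; first by rewrite mulnDr exprD mulrA.
move: sa; rewrite (path_sortedE geq_trans) => /andP[sa _].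
apply/allP=> b bal; have /= -> := allP sa b bal; rewrite andbT lt0n.
by apply: contraNneq al0 => <-.
Qed.

(** * Inversions as sums over pairs of cells *)

Definition letter1 : posnat := exist _ 1 isT.
Local Notation x0 := letter1.

Lemma colinvE c d : colinv c d = \sum_(i < size c) \sum_(j < size d)
  (((i == j :> nat) && (val (nth x0 d j) < val (nth x0 c i))) +
   ((j == i.+1 :> nat) && (val (nth x0 c i) < val (nth x0 d j)))).
Proof.
elim: c d => [|x c IHc] [|y d] /=; rewrite ?big_ord0 //.
  by rewrite big1 // => i _; rewrite big_ord0.
rewrite big_ord_recl [X in _ = X + _]big_ord_recl /= addn0; congr (_ + _ + _).
  case: d {IHc} => [|z d] /=; first by rewrite big_ord0.
  by rewrite big_ord_recl /= big1 ?addn0 ?add0n //.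
by rewrite IHc; apply: eq_bigr => i _; rewrite big_ord_recl.
Qed.

Lemma fillinvE T : fillinv T = \sum_(i < size T) \sum_(j < size T)
   (if i < j then colinv (nth [::] T i) (nth [::] T j) else 0).
Proof.
elim: T => [|c T IHT] /=; first by rewrite big_ord0.
rewrite big_ord_recl [X in _ = X + _]big_ord_recl /= add0n; congr (_ + _).
  by rewrite (big_nth [::]) big_mkord.
by rewrite IHT; apply: eq_bigr => i _; rewrite big_ord_recl.
Qed.

Lemma sum_iota n (F : nat -> nat) : \sum_(i < n) F i = \sum_(i <- iota 0 n) F i.
Proof. by rewrite -(big_mkord xpredT) /index_iota subn0. Qed.

(** * Reading a shape row by row *)

(** The cells of the path of semilength |lam| are read row by row from the top,
    and from left to right in each row.  Rows are numbered from 0 at the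
    bottom, and the row r occupies the columns off r, ..., off r + lam_r - 1
    (off = 0 aligns the rows to the left, off r = lam_0 - lam_r to the right).
    The sequence al gives the column heights of the resulting shape. *)
Section Reading.

Variables (lam al : seq nat) (off : nat -> nat).
Local Notation row := (nth 0 lam).

Hypothesis off_nested : forall r, r.+1 < size lam ->
  off r <= off r.+1 /\ off r.+1 + row r.+1 <= off r + row r.
Hypothesis off_shape : forall r c,
  (r < size lam) && (off r <= c < off r + row r) =
  (c < size al) && (r < nth 0 al c).

(** The number of cells in the rows r, r + 1, ...; hence the row r is read at
    the positions from above r.+1 on and before above r. *)
Definition above (r : nat) : nat := sumn (drop r lam).

Lemma aboveS r : r < size lam -> above r = row r + above r.+1.
Proof. by move=> rl; rewrite /above (drop_nth 0). Qed.

Lemma above_le r r' : r <= r' -> above r' <= above r.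
Proof.
move=> rr'; rewrite /above -(subnK rr') -drop_drop.
rewrite -[X in _ <= sumn X](cat_take_drop (r' - r)).
by rewrite sumn_cat leq_addl.
Qed.

Definition pos (u : nat * nat) : nat := above u.1.+1 + (u.2 - off u.1).

(** The position of the cell just below u, or the number of all cells when u is
    in the bottom row: the height of the path at the step of u. *)
Definition low (u : nat * nat) : nat :=
  if u.1 is r.+1 then pos (r, u.2) else sumn lam.

Definition rowcells (r : nat) : seq (nat * nat) :=
  [seq (r, c) | c <- iota (off r) (row r)].

Definition toprows (k : nat) : seq (nat * nat) :=
  flatten [seq rowcells r | r <- rev (iota 0 k)].

Lemma toprowsS k : toprows k.+1 = rowcells k ++ toprows k.
Proof. by rewrite /toprows -[k.+1]addn1 iotaD rev_cat. Qed.

Definition cells := toprows (size lam).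

Lemma map_pos_toprows k : k <= size lam ->
  map pos (toprows k) = iota (above k) (sumn lam - above k).
Proof.
elim: k => [|k IHk] kl; first by rewrite /above drop0 subnn.
rewrite toprowsS map_cat IHk ?(ltnW kl) //.
have := above_le (leq0n k); rewrite {2}/above drop0 (aboveS kl) => h.
have -> : sumn lam - above k.+1 = row k + (sumn lam - above k).
  by rewrite (aboveS kl); lia.
rewrite iotaD -aboveS // addnC -aboveS //; congr (_ ++ _).
rewrite /rowcells -[above k.+1 in RHS]addn0 -[off k in LHS]addn0.
rewrite !iotaDl -!map_comp.
by apply: eq_map => c /=; rewrite /pos /= addKn.
Qed.

Lemma map_pos : map pos cells = iota 0 (sumn lam).
Proof.
by rewrite map_pos_toprows // /above drop_size subn0.
Qed.

Lemma size_cells : size cells = sumn lam.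
Proof. by have := congr1 size map_pos; rewrite size_map size_iota. Qed.

Lemma mem_toprows k r c :
  ((r, c) \in toprows k) = (r < k) && (off r <= c < off r + row r).
Proof.
apply/flattenP/andP => [[s /mapP[r' ]]|[rk cr]].
  rewrite mem_rev mem_iota => /andP[_ r'k] -> /mapP[c'].
  by rewrite mem_iota => h [-> ->].
exists (rowcells r).
  by apply/mapP; exists r; rewrite ?mem_rev ?mem_iota.
by apply/mapP; exists c; rewrite ?mem_iota.
Qed.

Lemma mem_cells r c : ((r, c) \in cells) = (c < size al) && (r < nth 0 al c).
Proof. by rewrite mem_toprows off_shape. Qed.

Lemma cells_uniq : uniq cells.
Proof. by apply: (@map_uniq _ _ pos); rewrite map_pos iota_uniq. Qed.

Lemma pos_lt u : u \in cells -> pos u < sumn lam.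
Proof. by move/(map_f pos); rewrite map_pos mem_iota. Qed.

Lemma nth_cells_pos u u0 : u \in cells -> nth u0 cells (pos u) = u.
Proof.
move=> uc; have [i ic <-] := nthP u0 uc; congr nth.
have := congr1 (fun s => nth 0 s i) map_pos.
by rewrite (nth_map u0) // nth_iota -?size_cells.
Qed.

Lemma cell_at i : i < sumn lam -> exists2 u, u \in cells & pos u = i.
Proof.
move=> il; have : i \in map pos cells by rewrite map_pos mem_iota.
by case/mapP=> u uc ->; exists u.
Qed.

Lemma sum_cells (F : nat -> nat) :
  \sum_(i < sumn lam) F i = \sum_(u <- cells) F (pos u).
Proof. by rewrite sum_iota -map_pos big_map. Qed.

Definition attacks (u v : nat * nat) : bool :=
  ((u.1 == v.1) && (u.2 < v.2)) || ((u.1 == v.1.+1) && (v.2 < u.2)).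

(** The area holds the pairs of positions of u and of a cell read after u and
    before the cell below u: the rest of the row of u, then the cells of the
    next row strictly to the left of u.  As the rows are nested, nothing else
    lies between the two. *)
Lemma attacksE u v : u \in cells -> v \in cells ->
  (pos u < pos v) && (pos v < low u) = attacks u v.
Proof.
case: u v => [r c] [r' c'] uc vc; have := pos_lt vc.
move: uc vc; rewrite !mem_toprows => /andP[rl cr] /andP[r'l c'r'].
have := aboveS rl; have := aboveS r'l.
have leS i j : i < j -> above j <= above i.+1 by exact: above_le.
rewrite /attacks /low /pos /= => h' h.
case: (ltngtP r r') => [lt|gt|e].
- have := @above_le r.+1 r' lt; case: r rl cr h lt => [|r] *; lia.
- case: r rl cr h gt => // r rl cr h gt vn.
  rewrite eqSS; have [n1 n2] := off_nested rl.
  case: (ltngtP r r') gt => // [h1|gt'|e] h2; first by lia.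
    have := @above_le r'.+1 r gt'; have := aboveS (ltnW rl); lia.
  by subst r'; lia.
subst r'; case: r rl r'l cr h h' c'r' => [|r] rl r'l cr h h' c'r' vn.
  by lia.
by have := off_nested rl; lia.
Qed.

(** Outside the bottom row the heights increase from one cell to the next, so
    the east neighbour of the cell (pos u, low u) lies below the path, as the
    definition of a corner requires. *)
Lemma low_mono u v : u \in cells -> v \in cells -> 0 < u.1 ->
  pos u < pos v -> low u < low v.
Proof.
case: u v => [[|r] c] [r' c'] //= uc vc _.
have uv := pos_lt vc.
have lc : (r, c) \in cells.
  move: uc; rewrite !mem_cells => /andP[-> /ltnW]; exact.
have := pos_lt lc.
move: uc vc lc; rewrite !mem_toprows.
move=> /andP[rl cr] /andP[r'l c'r'] /andP[rl' cr'].
rewrite /low /pos /=; case: r' c'r' r'l uv => [|r'] c'r' r'l uv //.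
have h := aboveS rl; have h' := aboveS r'l; have h2 := aboveS rl'.
rewrite /pos /= in uv.
case: (ltngtP r r') => [lt|gt|e].
- by have := @above_le r.+2 r'.+1 lt; lia.
- by have := @above_le r'.+2 r.+1 gt; have := @above_le r'.+1 r gt; lia.
by subst r'; have := off_nested rl; lia.
Qed.

(** The filling whose row reading is s, as a list of columns. *)
Definition cols (s : seq posnat) : seq (seq posnat) :=
  [seq [seq nth x0 s (pos (r, c)) | r <- iota 0 (nth 0 al c)]
     | c <- iota 0 (size al)].

Definition readout (T : seq (seq posnat)) : seq posnat :=
  [seq nth x0 (nth [::] T u.2) u.1 | u <- cells].

Lemma nth_cols s c : c < size al ->
  nth [::] (cols s) c = [seq nth x0 s (pos (r, c)) | r <- iota 0 (nth 0 al c)].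
Proof. by move=> ca; rewrite (nth_map 0) ?size_iota // nth_iota. Qed.

Lemma cols_cell s r c : (r, c) \in cells ->
  nth x0 (nth [::] (cols s) c) r = nth x0 s (pos (r, c)).
Proof.
rewrite mem_cells => /andP[ca ra].
by rewrite nth_cols // (nth_map 0) ?size_iota // nth_iota.
Qed.

Lemma shape_cols s : shape (cols s) = al.
Proof.
apply: (@eq_from_nth _ 0); rewrite size_map size_map size_iota // => c ca.
rewrite (nth_map [::]) ?size_map ?size_iota // nth_cols //.
by rewrite size_map size_iota.
Qed.

Lemma colsK s : size s = sumn lam -> readout (cols s) = s.
Proof.
move=> sz; have -> : readout (cols s) = [seq nth x0 s (pos u) | u <- cells].
  by apply/eq_in_map => -[r c] uc; exact: cols_cell.
by rewrite (map_comp (nth x0 s) pos) map_pos -sz; exact: mkseq_nth.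
Qed.

Lemma readoutK T : shape T = al -> cols (readout T) = T.
Proof.
move=> shT; have szT : size T = size al by rewrite -shT size_map.
apply: (@eq_from_nth _ [::]); rewrite size_map size_iota // => c ca.
have szc : size (nth [::] T c) = nth 0 al c.
  by rewrite -shT (nth_map [::]) ?szT.
rewrite nth_cols //; apply: (@eq_from_nth _ x0); rewrite size_map size_iota //.
move=> r ra; rewrite (nth_map 0) ?size_iota // nth_iota //.
have uc : (r, c) \in cells by rewrite mem_cells ca.
by rewrite (nth_map (0, 0)) ?size_cells ?pos_lt // nth_cells_pos.
Qed.

Definition colcells : seq (nat * nat) :=
  [seq (r, c) | c <- iota 0 (size al), r <- iota 0 (nth 0 al c)].

Lemma perm_colcells : perm_eq cells colcells.
Proof.
apply: uniq_perm; first exact: cells_uniq.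
  apply: allpairs_uniq_dep => [|c _|]; rewrite ?iota_uniq //.
  by move=> [c r] [c' r'] _ _ [/= -> ->].
case=> r c; rewrite mem_cells; apply/andP/allpairsPdep => [[ca ra]|].
  by exists c, r; rewrite !mem_iota.
by case=> c' [r' []]; rewrite !mem_iota => ? ? [-> ->].
Qed.

Lemma flatten_cols s : size s = sumn lam -> perm_eq (flatten (cols s)) s.
Proof.
move=> sz; rewrite -{2}(colsK sz) /readout perm_sym.
apply: perm_trans (perm_map _ perm_colcells) _.
rewrite [X in perm_eq X _](_ : _ = flatten (cols s)) //.
rewrite /colcells /cols map_flatten -map_comp; congr flatten;
  apply/eq_in_map => c; rewrite mem_iota => /= ca.
rewrite -map_comp; apply/eq_in_map => r; rewrite mem_iota /= => ra.
by rewrite cols_cell // mem_cells ca.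
Qed.

(** Regrouping the attacking pairs by columns: a pair within a row is counted
    by its left cell, a pair in consecutive rows has its lower cell on the
    left, so each is one term of colinv of two columns in their order. *)
Lemma attacks_fillinv s : size s = sumn lam ->
  \sum_(u <- cells) \sum_(v <- cells)
     (attacks u v && (val (nth x0 s (pos v)) < val (nth x0 s (pos u)))) =
  fillinv (cols s).
Proof.
move=> sz; rewrite fillinvE size_map size_iota.
pose W r c := val (nth x0 s (pos (r, c))).
pose E c c' r r' := ((r == r' :> nat) && (W r' c' < W r c)) +
                    ((r' == r.+1) && (W r c < W r' c')).
have -> : \sum_(i < size al) \sum_(j < size al)
   (if i < j then colinv (nth [::] (cols s) i) (nth [::] (cols s) j) else 0) =
   \sum_(c <- iota 0 (size al)) \sum_(c' <- iota 0 (size al))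
   \sum_(r <- iota 0 (nth 0 al c)) \sum_(r' <- iota 0 (nth 0 al c'))
     (c < c') * E c c' r r'.
  rewrite -sum_iota; apply: eq_bigr => c _.
  rewrite -sum_iota; apply: eq_bigr => c' _.
  case: ifP => cc'; last by rewrite big1 // => r _; rewrite big1.
  rewrite colinvE !nth_cols // !size_map !size_iota -sum_iota.
  apply: eq_bigr => r _; rewrite -sum_iota; apply: eq_bigr => r' _.
  by rewrite mul1n !(nth_map 0) ?size_iota // !nth_iota.
rewrite (perm_big _ perm_colcells) /= big_allpairs_dep /=.
under eq_bigr => c _.
  under eq_bigr => r _.
    rewrite (perm_big _ perm_colcells) /= big_allpairs_dep /=; over.
  rewrite exchange_big /=; over.
pose A c c' r r' := (c < c') * ((r == r' :> nat) && (W r' c' < W r c)).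
pose B c c' r r' := (c < c') * ((r' == r.+1 :> nat) && (W r c < W r' c')).
(* A collects the pairs inside a row and B the pairs in consecutive rows, whose
   attacking cell is the one on the right; exchanging the names of the two
   cells in the sum of B gives the second form. *)
transitivity (\sum_(c <- iota 0 (size al)) \sum_(c' <- iota 0 (size al))
   \sum_(r <- iota 0 (nth 0 al c)) \sum_(r' <- iota 0 (nth 0 al c'))
     (A c c' r r' + B c' c r' r)).
  apply: eq_bigr => c _; apply: eq_bigr => c' _; apply: eq_bigr => r _.
  apply: eq_bigr => r' _; rewrite /A /B /attacks /= -/(W r c) -/(W r' c').
  by case: (ltngtP c c') => _; rewrite ?andbF ?andbT ?orbF /=; lia.
transitivity (\sum_(c <- iota 0 (size al)) \sum_(c' <- iota 0 (size al))
   \sum_(r <- iota 0 (nth 0 al c)) \sum_(r' <- iota 0 (nth 0 al c'))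
     (A c c' r r' + B c c' r r')); last first.
  do 4!(apply: eq_bigr => ? _); rewrite /A /B /E; lia.
pose S4 F := \sum_(c <- iota 0 (size al)) \sum_(c' <- iota 0 (size al))
   \sum_(r <- iota 0 (nth 0 al c)) \sum_(r' <- iota 0 (nth 0 al c'))
     (F c c' r r' : nat).
have S4D F G : S4 (fun c c' r r' => F c c' r r' + G c c' r r') = S4 F + S4 G.
  rewrite /S4 -big_split; apply: eq_bigr => c _; rewrite -big_split.
  apply: eq_bigr => c' _; rewrite -big_split; apply: eq_bigr => r _.
  by rewrite -big_split.
rewrite -/(S4 (fun c c' r r' => A c c' r r' + B c' c r' r)).
rewrite -/(S4 (fun c c' r r' => A c c' r r' + B c c' r r')).
rewrite !S4D; congr (_ + _); rewrite /S4 exchange_big.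
apply: eq_bigr => c _; apply: eq_bigr => c' _; exact: exchange_big.
Qed.

(** * From a path to the fillings of its shape *)

Variable pi : dyck (sumn lam).
Hypothesis heights_pi : east_heights 0 pi = map low cells.

Lemma height_cell u : u \in cells -> height pi (pos u) = low u.
Proof.
move=> uc; rewrite /height heights_pi (nth_map (0, 0)) ?size_cells ?pos_lt //.
by rewrite nth_cells_pos.
Qed.

Lemma inv_filling (w : (sumn lam).-tuple posnat) :
  inv pi w = fillinv (cols w).
Proof.
rewrite -attacks_fillinv ?size_tuple // /inv -sum1dep_card big_mkcond.
pose B i j := (i < j < height pi i) &&
   (val (nth x0 w j) < val (nth x0 w i)).
transitivity (\sum_(c : 'I_(sumn lam) * 'I_(sumn lam)) B c.1 c.2).
  apply: eq_bigr => -[i j] _.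
  by rewrite inE /B !(tnth_nth x0) /below /=; case: ifP.
rewrite -(pair_bigA _ (fun i j : 'I_(sumn lam) => B i j : nat)).
rewrite (sum_cells (fun i => \sum_(j < sumn lam) B i j)).
apply: eq_big_seq => u uc; rewrite (sum_cells (B _)).
by apply: eq_big_seq => v vc; rewrite /B height_cell // attacksE.
Qed.

Lemma cell_below r c : (r.+1, c) \in cells -> (r, c) \in cells.
Proof. by rewrite !mem_cells => /andP[-> /ltnW]. Qed.

Lemma pos_below r c : (r.+1, c) \in cells -> pos (r.+1, c) < pos (r, c).
Proof.
move=> uc; have := cell_below uc; move: uc.
rewrite !mem_toprows /pos /= => /andP[rl cr] /andP[rl' cr'].
by have := aboveS rl; have := off_nested rl; lia.
Qed.

(** The row index of a corner is the height of the path, hence the position of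
    the cell below the one at its column index.  The cells of the bottom row
    give no corner, their height being the size of the grid. *)
Lemma cornersP (i j : 'I_(sumn lam)) :
  reflect (exists r c, [/\ (r.+1, c) \in cells, i = pos (r.+1, c) :> nat &
                          j = pos (r, c) :> nat])
          ((i, j) \in corners pi).
Proof.
apply: (iffP idP); rewrite inE /below /=.
  have [[r c] uc ui] := cell_at (ltn_ord i); rewrite -ui height_cell //.
  rewrite -leqNgt => /and3P[jl _ jl'].
  case: r uc ui jl jl' => [|r] uc ui; rewrite /low /= => jl jl'.
    by have := ltn_ord j; rewrite ltnNge jl.
  exists r, c; split=> //; apply/eqP; rewrite eqn_leq jl andbT.
  by have := pos_below uc; lia.
case=> r [c [uc -> jE]]; rewrite height_cell // /low /= jE ltnn /=.
have bl := pos_below uc; have := pos_lt (cell_below uc) => ltn.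
have [v vc vE] := cell_at (leq_ltn_trans bl ltn).
rewrite -vE height_cell //; rewrite ltn_predL (leq_ltn_trans _ bl) // andbT.
by apply: (low_mono uc vc) => //; rewrite vE.
Qed.

Lemma sorted_cols_corners s (w : (sumn lam).-tuple posnat) :
  reflect (forall c, c \in corners pi -> climbs s (tnth w c.2) (tnth w c.1))
          (all (sorted (climbs s)) (cols w)).
Proof.
apply: (iffP allP) => [Ws [i j] /cornersP[r [c [uc iE jE]]] | Wc t].
  rewrite /= !(tnth_nth x0) iE jE -!cols_cell ?(cell_below uc) //.
  move: uc; rewrite mem_cells => /andP[ca ra].
  have/(sortedP x0) : sorted (climbs s) (nth [::] (cols w) c).
    by apply: Ws; rewrite mem_nth // size_map size_iota.
  by apply; rewrite nth_cols // size_map size_iota.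
case/mapP=> c; rewrite mem_iota => /= ca ->.
apply/(sortedP x0) => r; rewrite size_map size_iota => ra.
rewrite !(nth_map 0) ?size_iota ?(ltnW ra) // !nth_iota ?(ltnW ra) //.
have uc : (r.+1, c) \in cells by rewrite mem_cells ca.
have := Wc (Ordinal (pos_lt uc), Ordinal (pos_lt (cell_below uc))).
by rewrite !(tnth_nth x0) /=; apply; apply/cornersP; exists r, c.
Qed.

(** The statistic of the corners has the least, respectively the greatest,
    possible value exactly when all corners behave in the same way, which is
    monotonicity of the columns. *)
Lemma corner_stat_extremal (s : bool) (w : (sumn lam).-tuple posnat) :
  (corner_stat pi w == if s then 0 else #|corners pi|) =
  all (sorted (climbs s)) (cols w).
Proof.
apply/idP/sorted_cols_corners; case: s; rewrite /climbs /corner_stat.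
- rewrite cards_eq0 => /eqP/setP e c cc; have := e c.
  by rewrite in_set cc in_set0 /= ltnNge => ->.
- move=> e c cc; set C := [set _ in _ | _] in e.
  have : C == corners pi.
    rewrite eqEcard (eqP e) leqnn andbT.
    by apply/subsetP=> d; rewrite in_set => /andP[].
  by move/eqP/setP/(_ c); rewrite cc in_set => /andP[].
- move=> h; rewrite cards_eq0; apply/eqP/setP=> c; rewrite [RHS]inE inE.
  by apply/negP => /andP[/h]; rewrite ltnNge => /negP.
move=> h; apply/eqP; congr #|pred_of_set _|; apply/setP=> c; rewrite in_set.
by apply/andb_idr => /h.
Qed.

Lemma chi_shapesum (s : bool) m :
  ((chi pi m)`_(if s then 0 else #|corners pi|))%R = shapesum s m al.
Proof.
rewrite /chi coef_sum; set k := if s then _ else _.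
pose P (w : (sumn lam).-tuple (finsupp m)) :=
  (xmon (map_tuple val w) == m) && (corner_stat pi (map_tuple val w) == k).
transitivity (\sum_(w | P w) 'X^(inv pi (map_tuple val w)) : {poly int})%R.
  rewrite [RHS]big_mkcondr; apply: eq_bigr => w _.
  rewrite /qvar /tvar -polyC_exp mul_polyC coefZ coefXn eq_sym.
  by case: eqP; rewrite ?mulr1 ?mulr0.
have sz (w : (sumn lam).-tuple (finsupp m)) : size (map val w) = sumn lam.
  by rewrite size_map size_tuple.
have alE : sumn al = sumn lam.
  rewrite -size_cells (perm_size perm_colcells) size_allpairs_dep.
  by rewrite (eq_map (fun x => size_iota 0 _)) -/(mkseq _ _) mkseq_nth.
have xmonE (w : (sumn lam).-tuple (finsupp m)) :
    content (flatten (cols (map val w))) = xmon (map_tuple val w).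
  rewrite (content_perm (flatten_cols (sz w))).
  by rewrite /content /xmon -[in LHS]/(tval (map_tuple val w)) big_tuple.
rewrite /shapesum.
apply: (@big_seq_bij _ _ _ _ _ P _ _ _
  (fun w : (sumn lam).-tuple (finsupp m) => cols (map val w))).
- exact: index_enum_uniq.
- exact: fillings_uniq.
- move=> w _ /andP[wm wk]; rewrite mem_fillings shape_cols eqxx /=.
  rewrite xmonE wm -(corner_stat_extremal s (map_tuple val w)) wk.
  rewrite inv_filling; split=> //.
  rewrite (perm_all _ (flatten_cols (sz w))).
  by apply/allP=> x /mapP[y _ ->]; exact: valP.
- move=> u w _ _ /(congr1 readout); rewrite !colsK //.
  by move/(inj_map val_inj)/val_inj.
move=> T; rewrite mem_fillings => /andP[/eqP shT TD] /andP[Ts Tm].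
have: readout T \in words (finsupp m) (sumn lam).
  rewrite mem_words size_map size_cells eqxx /=.
  rewrite -(perm_all _ (flatten_cols _)) ?size_map ?size_cells //.
  by rewrite readoutK.
case/mapP=> w _ wE; have wT : cols (map val w) = T by rewrite -wE readoutK.
exists w; split; rewrite ?mem_index_enum // /P.
rewrite -xmonE (corner_stat_extremal s (map_tuple val w)).
by rewrite -[X in all _ (cols X)]/(map val w) wT Ts Tm.
Qed.

End Reading.

(** * The two paths of a partition *)

Lemma east_heights_cat a s1 s2 : east_heights a (s1 ++ s2) =
  east_heights a s1 ++ east_heights (a + count_mem North s1) s2.
Proof.
elim: s1 a => [|[] s1 IHs] a /=; first by rewrite addn0.
  by rewrite IHs addSnnS.
by rewrite IHs.
Qed.

Lemma east_heights_Ns a k : east_heights a (Ns k) = [::].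
Proof. by elim: k a => //= k IHk a. Qed.

Lemma east_heights_Es a k : east_heights a (Es k) = nseq k a.
Proof. by elim: k => //= k ->. Qed.

Lemma east_heights_ENs a k : east_heights a (ENs k) = iota a k.
Proof. by elim: k a => //= k IHk a; rewrite IHk. Qed.

(** After the letters of the row r + 1 the path climbs off (r + 1) - off r
    steps before its steps EN.  This puts the height of each of these E at the
    position of the cell below, and the remaining N steps bring the height to
    the end of the row r. *)
Lemma east_heights_path lam off (seg : nat -> seq step) (rest : nat -> nat) :
    (forall r, r.+1 < size lam -> off r <= off r.+1 /\
       off r.+1 + nth 0 lam r.+1 <= off r + nth 0 lam r) ->
    (forall r, r.+1 < size lam ->
       seg r.+2 = Ns (off r.+1 - off r) ++ ENs (nth 0 lam r.+1) ++ Ns (rest r)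
       /\ off r.+1 - off r + nth 0 lam r.+1 + rest r = nth 0 lam r) ->
  east_heights 0 (path_word lam seg) = map (low lam off) (cells lam off).
Proof.
move=> nested segE; rewrite /path_word.
pose T k := flatten [seq seg j | j <- rev (iota 2 k)] ++ Es (part lam 1).
have TS k : T k.+1 = seg k.+2 ++ T k.
  rewrite /T (_ : iota 2 k.+1 = rcons (iota 2 k) k.+2); last first.
    by rewrite -cats1 -[in LHS](addn1 k) iotaD.
  by rewrite rev_rcons /= catA.
have main k : k < size lam ->
    east_heights (above lam k) (T k) = map (low lam off) (toprows lam off k.+1).
  elim: k => [|k IHk] kl.
    rewrite /T /= east_heights_Es /above drop0 /toprows /= cats0 -map_comp.
    rewrite /part /= -[X in nseq X _](size_iota (off 0)).
    by elim: (iota _ _) => //= x s ->.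
  have [sE szE] := segE k kl; have [n1 n2] := nested k kl.
  rewrite TS sE toprowsS map_cat -IHk ?(ltnW kl) //.
  move: (T k) => t; rewrite !east_heights_cat.
  rewrite !east_heights_Ns east_heights_ENs !count_cat count_ENs !count_nseq /=.
  rewrite cats0 !mul1n; congr (_ ++ east_heights _ _).
    rewrite /rowcells -[off k.+1 in RHS]addn0 -[X in iota X _]addn0 !iotaDl.
    by rewrite -!map_comp; apply: eq_map => c; rewrite /= /low /pos /=; lia.
  by rewrite (aboveS (ltnW kl)) -szE; have := aboveS kl; lia.
case: (posnP (size lam)) => [/size0nil ->|l0] //.
have := main (size lam).-1; rewrite prednK // => /(_ (leqnn _)).
rewrite east_heights_cat east_heights_Ns /= count_nseq /= mul1n add0n => <-.
rewrite /T; congr (east_heights _ _).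
rewrite aboveS ?prednK // /above drop_size addn0.
by rewrite /part.
Qed.

Definition conj_parts (lam : seq nat) : seq nat :=
  [seq conj_part lam j.+1 | j <- iota 0 (part lam 1)].

Lemma size_conj_parts lam : size (conj_parts lam) = part lam 1.
Proof. by rewrite size_map size_iota. Qed.

Lemma nth_nonincreasing lam r : sorted geq lam ->
  nth 0 lam r.+1 <= nth 0 lam r.
Proof.
move=> sl; case: (ltnP r.+1 (size lam)) => rl; last by rewrite nth_default.
exact: (sortedP 0 sl r rl).
Qed.

Lemma nth_le_head lam r : sorted geq lam -> nth 0 lam r <= part lam 1.
Proof.
case: lam r => [|a lam] [|r] //=; rewrite /part /=.
rewrite (path_sortedE geq_trans) => /andP[ga _].
case: (ltnP r (size lam)) => rl; last by rewrite nth_default.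
exact: all_nthP ga _ rl.
Qed.

(** Both sides say that the box in row r and column j, numbered from 0, belongs
    to the diagram. *)
Lemma conj_part_gt lam r j : sorted geq lam ->
  (r < conj_part lam j.+1) = (j < nth 0 lam r).
Proof.
elim: lam r => [|a lam IHl] r; first by case: r.
move=> sl; have := nth_le_head _ sl; move/path_sorted: sl => sl.
rewrite {1}/conj_part /= -/(conj_part lam j.+1) => ga.
case: r => [|r] /=.
  case: (ltnP j a) => //= aj; apply/negbTE; rewrite (IHl 0 sl) -leqNgt.
  by have := ga 1 => /=; rewrite /part /=; lia.
rewrite -IHl //; case: (ltnP j a) => //= aj.
rewrite add0n !IHl //; have := ga r.+1; have := ga r.+2.
by rewrite /part /=; lia.
Qed.

Lemma nth_conj_parts lam c :
  c < part lam 1 -> nth 0 (conj_parts lam) c = conj_part lam c.+1.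
Proof. by move=> cl; rewrite (nth_map 0) ?size_iota // nth_iota. Qed.

Lemma conj_parts_sorted lam : sorted geq (conj_parts lam).
Proof.
apply/(sortedP 0) => i; rewrite size_conj_parts => il.
rewrite !nth_conj_parts ?(ltnW il) //=.
by apply: sub_count => a /ltnW.
Qed.

Lemma conj_parts_gt0 lam : sorted geq lam -> 0 \notin conj_parts lam.
Proof.
move=> sl; apply/mapP => -[c]; rewrite mem_iota /= add0n => cl /esym/eqP.
by rewrite -leqn0 leqNgt conj_part_gt // -[nth _ _ _]/(part lam 1) cl.
Qed.

Section Paths.
Variable lam : intpart.
Let lam_sorted : sorted geq lam. Proof. by case/andP: (partsP lam). Qed.
Let row_le r : nth 0 lam r.+1 <= nth 0 lam r.
Proof. exact: nth_nonincreasing. Qed.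

(** With s = true this is the coefficient of t^0 in chi, with s = false that of
    t to the number of corners. *)
Lemma chi_Inv s m :
  ((chi (pi_Inv lam) m)`_(if s then 0 else #|corners (pi_Inv lam)|))%R =
  shapesum s m (conj_parts lam).
Proof.
apply: (@chi_shapesum _ _ (fun=> 0)).
- by move=> r _; rewrite !add0n.
- move=> r c; rewrite size_conj_parts !add0n /=.
  apply/andP/andP => [[rl cr]|[cl]].
    have cl := leq_trans cr (nth_le_head r lam_sorted).
    by rewrite nth_conj_parts // conj_part_gt.
  rewrite nth_conj_parts // conj_part_gt // => cr; split=> //.
  by rewrite ltnNge; apply: contraTN cr => rl; rewrite nth_default.
apply: (@east_heights_path _ _ _
  (fun r => nth 0 lam r - nth 0 lam r.+1)) => [r _|r _].
  by rewrite !add0n.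
by split=> //; rewrite subn0 add0n subnKC.
Qed.

Lemma chi_Quinv s m :
  ((chi (pi_Quinv lam) m)`_(if s then 0 else #|corners (pi_Quinv lam)|))%R =
  shapesum s m (rev (conj_parts lam)).
Proof.
pose off r := part lam 1 - nth 0 lam r.
have h r := nth_le_head r lam_sorted.
have nested r : off r <= off r.+1 /\
    off r.+1 + nth 0 lam r.+1 <= off r + nth 0 lam r.
  by rewrite /off; have := h r; have := h r.+1; have := row_le r; lia.
apply: (@chi_shapesum _ _ off).
- by move=> r _; exact: nested.
- move=> r c; rewrite size_rev size_conj_parts.
  rewrite /off subnK //; case: (ltnP c (part lam 1)) => cl; rewrite ?andbF //=.
  rewrite andbT nth_rev size_conj_parts // nth_conj_parts; last by lia.
  rewrite conj_part_gt //; case: (ltnP r (size lam)) => rl /=.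
    by have := h r; lia.
  by rewrite nth_default.
apply: (@east_heights_path _ off _ (fun=> 0)) => [r _|r _]; first exact: nested.
have -> : off r.+1 - off r = nth 0 lam r - nth 0 lam r.+1.
  by rewrite /off; have := h r; have := h r.+1; have := row_le r; lia.
by rewrite cats0 addn0 subnK.
Qed.

End Paths.

(** * The exponents of q *)

(** Adding a bottom row to a diagram raises its columns by one and adds k
    columns of height 1; each of the latter differs from each of the former. *)
Lemma descending_pairs_border (x : seq nat) k : 0 \notin x ->
  descending_pairs (map S x ++ nseq k 1) = descending_pairs x + size x * k.
Proof.
elim: x => [_|a x IHx] /=.
  by elim: k => //= k IHk; rewrite IHk addn0 count_nseq.
rewrite inE negb_or => /andP[a0 x0]; rewrite IHx // count_cat count_nseq.
rewrite count_map -[X in X + _ + _](@eq_count _ (fun b => b < a)) //.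
move: a0; rewrite eq_sym -lt0n => a0.
by rewrite ltnS a0 mul1n mulSn addnACA addnA.
Qed.

Lemma conj_parts_cons a lam : sorted geq (a :: lam) ->
  conj_parts (a :: lam) =
  map S (conj_parts lam) ++ nseq (a - part lam 1) 1.
Proof.
move=> sl; have ba : part lam 1 <= a by exact: (nth_le_head 1 sl).
have sl' := path_sorted sl.
have e : iota 0 (part (a :: lam) 1) =
    iota 0 (part lam 1) ++ iota (part lam 1) (a - part lam 1).
  by rewrite -{2}[part lam 1]add0n -iotaD subnKC.
rewrite /conj_parts e map_cat.
congr (_ ++ _).
  rewrite -map_comp; apply/eq_in_map => j; rewrite mem_iota /= => jl.
  by rewrite /conj_part /= (leq_trans jl ba).
apply: (@eq_from_nth _ 0); rewrite size_map size_iota ?size_nseq // => i il.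
rewrite (nth_map 0) ?size_iota // nth_iota // nth_nseq il /=.
rewrite /conj_part /= -/(conj_part lam _) -ltn_subRL il; congr S.
by apply/eqP; rewrite -leqn0 leqNgt conj_part_gt // -leqNgt leq_addr.
Qed.

Lemma alpha_InvE lam : alpha_Inv lam =
  \sum_(i < size lam) \sum_(j < nth 0 lam i.+1) (nth 0 lam i.+1 - j.+1).
Proof.
(* The bottom row has coleg 0 and drops out, which shifts the index of the
   other rows; the last summand on the right is empty. *)
rewrite /alpha_Inv big_add1 /= big_mkord.
case: lam => [|a lam]; first by rewrite !big_ord0.
rewrite [size _]/= big_ord_recl big_pred0 // add0n big_ord_recr /=.
rewrite (nth_default 0 (leqnn _)) big_ord0 addn0.
apply: eq_bigr => i _; rewrite big_add1 /= big_mkord.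
by apply: eq_bigr.
Qed.

Lemma alpha_QuinvE lam : sorted geq lam -> alpha_Quinv lam =
  \sum_(i < size lam) \sum_(j < nth 0 lam i.+1) (nth 0 lam i - j.+1).
Proof.
move=> sl; rewrite /alpha_Quinv big_add1 /= big_mkord.
apply: eq_bigr => i _; rewrite big_add1 /= big_mkord.
have h := nth_nonincreasing i sl.
rewrite (big_ord_widen_cond _ xpredT (fun j => nth 0 lam i - j.+1) h).
apply: eq_bigl => j /=.
by rewrite /leg -conj_part_gt // subn_eq0 -ltnNge.
Qed.

(** Compare the boxes in a column at the rows i + 1 and i: their arms differ by
    lam_i - lam_(i+1).  The sum of these differences counts the pairs of a
    column that reaches the row i + 1 and a column that ends in the row i. *)
Lemma alpha_descents lam : sorted geq lam ->
  alpha_Quinv lam = alpha_Inv lam + descending_pairs (conj_parts lam).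
Proof.
move=> sl; have -> : descending_pairs (conj_parts lam) =
    \sum_(i < size lam) nth 0 lam i.+1 * (nth 0 lam i - nth 0 lam i.+1).
  elim: lam sl => [|a lam IHl] sl; first by rewrite big_ord0.
  have sl' := path_sorted sl.
  rewrite conj_parts_cons // descending_pairs_border ?conj_parts_gt0 // IHl //.
  by rewrite size_conj_parts big_ord_recl addnC.
rewrite alpha_QuinvE // alpha_InvE -big_split; apply: eq_bigr => i _.
have h := nth_nonincreasing i sl.
rewrite /= -[X in _ = _ + X * _]card_ord -sum_nat_const -big_split.
by apply: eq_bigr => j _ /=; have := ltn_ord j; lia.
Qed.

(** * Comparison of the two paths *)

Theorem theorem2p8 (lam : intpart) :
  (qshift (alpha_Quinv lam) (t_eq0 (chi (pi_Quinv lam)))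
     =1 qshift (alpha_Inv lam) (t_eq0 (chi (pi_Inv lam))))
  /\
  (t_coef #|corners (pi_Inv lam)| (chi (pi_Inv lam))
     =1 t_coef #|corners (pi_Quinv lam)| (chi (pi_Quinv lam))).
Proof.
have sl : sorted geq lam by case/andP: (partsP lam).
have revE s m : (shapesum s m (rev (conj_parts lam)) =
    shapesum s m (conj_parts lam) *
    'X^(s * descending_pairs (conj_parts lam)))%R.
  have := @shapesum_rev s m [::] (conj_parts lam) [::].
  by rewrite !cats0; apply; rewrite ?conj_parts_sorted ?conj_parts_gt0.
split=> m; last first.
  rewrite /t_coef (chi_Inv lam false) (chi_Quinv lam false) revE.
  (* In the weak case the columns are exchanged without any factor. *)
  by rewrite mul0n mulr1.
rewrite /qshift /t_eq0 !horner_coef0 (chi_Inv lam true) (chi_Quinv lam true).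
rewrite revE mul1n alpha_descents // exprD rmorphM rmorphXn invfM /=.
rewrite -mulrA [(tofrac (shapesum _ _ _) * _)%R]mulrC mulKf //.
by rewrite expf_neq0 // tofrac_eq0 polyX_eq0.
Qed.
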